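(* Let $N\in\mathbb{N}$ and $\chi=\{0,\dots,N-1\}$. A random variable $\xi$ taking values in $\chi$ is max-stable if and only if it is degenerate at some point $x\in\chi$.
   Context: Here $\chi$ is equipped with the operation $x\oplus y=\max\{x,y\}$. A random variable $\xi$ taking values in $\chi$ is called max-stable if $\xi_1\oplus\xi_2=\max\{\xi_1,\xi_2\}$ has the same distribution as $\xi$, where $\xi_1,\xi_2$ are independent copies of $\xi$. *)

(* Defs.v *)
From HB Require Import structures.
From mathcomp Require Import all_boot all_order all_algebra.
From mathcomp Require Import all_classical all_reals all_analysis.

Set Implicit Arguments.
Unset Strict Implicit.
Unset Printing Implicit Defensive.

Import Order.TTheory GRing.Theory Num.Theory.

Local Open Scope classical_set_scope.
Local Open Scope ereal_scope.

(* A measurableType must be inhabited, hence 'I_n.+1 rather than 'I_n: the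
   state space {0, ..., N - 1} with N >= 1 is 'I_n.+1 for n = N - 1.  For N = 0
   it is empty and carries no random variable. *)
HB.instance Definition _ (n : nat) := isPointed.Build 'I_n.+1 ord0.

HB.instance Definition _ (n : nat) :=
  @isMeasurable.Build default_measure_display 'I_n.+1 discrete_measurable
    discrete_measurable0 discrete_measurableC discrete_measurableU.

Section max_random_variable.
Context d (T : measurableType d) (n : nat).
Variables X Y : {mfun T >-> 'I_n.+1}.

Definition rv_max (t : T) : 'I_n.+1 := Order.max (X t) (Y t).

Let measurable_rv_max : measurable_fun setT rv_max.
Proof.
move=> _ A _; rewrite setTI.
have -> : rv_max @^-1` A =
    \bigcup_(p in [set p : 'I_n.+1 * 'I_n.+1 | A (Order.max p.1 p.2)])
      (X @^-1` [set p.1] `&` Y @^-1` [set p.2]).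
  apply/seteqP; split=> [t At|t [[i j] /= Aij [Xi Yj]]].
    by exists (X t, Y t).
  by rewrite /rv_max Xi Yj.
apply: fin_bigcup_measurable; first exact: finite_finset.
by move=> p _; apply: measurableI; apply: measurable_funPTI.
Qed.

HB.instance Definition _ :=
  isMeasurableFun.Build _ _ T 'I_n.+1 rv_max measurable_rv_max.

End max_random_variable.

Section probability_notions.
Context d d' (T : measurableType d) (E : measurableType d') (R : realType).
Variable P : probability T R.

Definition independent_rv (X Y : {RV P >-> E}) : Prop :=
  forall A B : set E, measurable A -> measurable B ->
    P (X @^-1` A `&` Y @^-1` B) = P (X @^-1` A) * P (Y @^-1` B).

Definition degenerate_at (X : {RV P >-> E}) (x : E) : Prop :=
  P (X @^-1` [set x]) = 1.

End probability_notions.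

(* The two random variables may live on different probability spaces. *)
Definition same_distribution d1 d2 d' (T1 : measurableType d1)
    (T2 : measurableType d2) (E : measurableType d') (R : realType)
    (P1 : probability T1 R) (P2 : probability T2 R)
    (X1 : {RV P1 >-> E}) (X2 : {RV P2 >-> E}) : Prop :=
  forall A : set E, measurable A ->
    distribution P1 X1 A = distribution P2 X2 A.

(* The independent copies may live on any probability space (T', Q): T itself
   may be too small to carry them, while T * T with P \x P always does. *)
Definition max_stable d (T : measurableType d) (R : realType)
    (P : probability T R) (n : nat) (xi : {RV P >-> 'I_n.+1}) : Prop :=
  forall (d' : measure_display) (T' : measurableType d')
         (Q : probability T' R) (xi1 xi2 : {RV Q >-> 'I_n.+1}),
    same_distribution xi1 xi -> same_distribution xi2 xi ->
    independent_rv xi1 xi2 ->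
    same_distribution (rv_max xi1 xi2 : {RV Q >-> 'I_n.+1}) xi.

(* Main.v *)
Require Import Defs.
From HB Require Import structures.
From mathcomp Require Import all_boot all_order all_algebra.
From mathcomp Require Import all_classical all_reals all_analysis.

(** Max-stability is a statement about the distribution function.  If [X], [Y]
    are independent copies of [xi], then [max X Y < k] means [X < k] and
    [Y < k], so the numbers [P (xi < k)] satisfy [p * p = p]: each of them is
    [0] or [1] ([max_stable_lt_zero_one]; the independent copies are the two
    coordinates of the product space [T * T]).  The state space being finite,
    this sequence jumps from [0] at [k = 0] to [1] at [k = n + 1], and all the
    mass of [xi] sits at the jump.

    Conversely, a variable degenerate at [x] has the Dirac distribution at [x]
    ([degenerate_distribution]), and the maximum of two independent variables
    degenerate at [x] is degenerate at [x] ([degenerate_rv_max]). *)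

Set Implicit Arguments.
Unset Strict Implicit.
Unset Printing Implicit Defensive.

Import Order.TTheory GRing.Theory Num.Theory.
Local Open Scope classical_set_scope.
Local Open Scope ereal_scope.

Section degenerate.
Context d (T : measurableType d) (R : realType) (P : probability T R).

Lemma degenerate_distribution d' (E : measurableType d') (X : {RV P >-> E})
    (x : E) (A : set E) :
  measurable [set x] -> measurable A -> degenerate_at X x ->
  distribution P X A = dirac x A.
Proof.
move=> mx mA Xx.
have mXA B : measurable B -> measurable (X @^-1` B).
  by move=> mB; exact: measurable_funPTI.
have one B : measurable B -> B x -> P (X @^-1` B) = 1.
  move=> mB Bx; apply/eqP; rewrite eq_le probability_le1; last exact: mXA.
  rewrite andTb -[leLHS]Xx.
  apply: le_measure; rewrite ?inE; [exact: mXA|exact: mXA|].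
  by move=> t /= ->.
rewrite diracE; case: (boolP (x \in A)) => [/set_mem Ax|/negP xA].
  exact: one.
have nAx : (~` A) x by move=> Ax; apply: xA; exact: mem_set.
rewrite -[A]setCK; rewrite /distribution /pushforward preimage_setC.
rewrite probability_setC; last exact: (mXA _ (measurableC mA)).
by rewrite (one _ (measurableC mA) nAx) subee.
Qed.

Lemma degenerate_rv_max n (X Y : {RV P >-> 'I_n.+1}) (x : 'I_n.+1) :
  independent_rv X Y -> degenerate_at X x -> degenerate_at Y x ->
  degenerate_at (rv_max X Y : {RV P >-> 'I_n.+1}) x.
Proof.
move=> indep Xx Yx.
have mX (Z : {RV P >-> 'I_n.+1}) : measurable (Z @^-1` [set x]).
  exact: measurable_funPTI.
apply/eqP; rewrite eq_le probability_le1 ?andTb; last exact: mX.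
have <- : P (X @^-1` [set x] `&` Y @^-1` [set x]) = 1.
  by rewrite indep // Xx Yx mule1.
apply: le_measure; rewrite ?inE; [exact: measurableI|exact: mX|].
by move=> t /= [Xt Yt]; rewrite /rv_max Xt Yt maxxx.
Qed.

End degenerate.

Section independent_copies.
Context d (T : measurableType d) (R : realType) (P : probability T R).
Context d' (E : measurableType d') (X : {RV P >-> E}).

(** The two coordinates of the product space [(T * T, P \x P)] composed with
    [X]: independent copies of [X]. *)
Definition copy1 (t : T * T) : E := X t.1.
Definition copy2 (t : T * T) : E := X t.2.

Let measurable_copy1 : measurable_fun setT copy1.
Proof. exact: measurableT_comp measurable_fst. Qed.

Let measurable_copy2 : measurable_fun setT copy2.
Proof. exact: measurableT_comp measurable_snd. Qed.

HB.instance Definition _ :=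
  isMeasurableFun.Build _ _ (T * T)%type E copy1 measurable_copy1.
HB.instance Definition _ :=
  isMeasurableFun.Build _ _ (T * T)%type E copy2 measurable_copy2.

(** The same two functions, typed as random variables for [P \x P]. *)
Definition copy1_rv : {RV (P \x P) >-> E} := copy1.
Definition copy2_rv : {RV (P \x P) >-> E} := copy2.

Lemma copies_joint_probability (A B : set E) :
  measurable A -> measurable B ->
  (P \x P) (copy1 @^-1` A `&` copy2 @^-1` B) = P (X @^-1` A) * P (X @^-1` B).
Proof.
move=> mA mB; rewrite -product_measure1E //; exact: measurable_funPTI.
Qed.

Lemma copy1_same_distribution : same_distribution copy1_rv X.
Proof.
move=> A mA; rewrite /distribution /pushforward.
have := copies_joint_probability mA (@measurableT _ E).
by rewrite !preimage_setT setIT probability_setT mule1.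
Qed.

Lemma copy2_same_distribution : same_distribution copy2_rv X.
Proof.
move=> A mA; rewrite /distribution /pushforward.
have := copies_joint_probability (@measurableT _ E) mA.
by rewrite !preimage_setT setTI probability_setT mul1e.
Qed.

Lemma copies_independent : independent_rv copy1_rv copy2_rv.
Proof.
move=> A B mA mB; apply: (eq_trans (copies_joint_probability mA mB)).
congr (_ * _); symmetry.
  exact: copy1_same_distribution.
exact: copy2_same_distribution.
Qed.

End independent_copies.

Lemma probability_idem d (T : measurableType d) (R : realType)
    (P : probability T R) (A : set T) :
  measurable A -> P A * P A = P A -> P A = 0 \/ P A = 1.
Proof.
move=> mA; rewrite -(fineK (fin_num_measure P A mA)) -EFinM => -[] /eqP.
rewrite -subr_eq0 -{3}[fine _]mulr1 -mulrBr mulf_eq0 subr_eq0.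
by case/orP=> /eqP ->; [left|right].
Qed.

(** A zero-one law for the distribution function: [max X Y < k] holds exactly
    when [X < k] and [Y < k], so by independence [P (xi < k)] is idempotent. *)
Lemma max_stable_lt_zero_one d (T : measurableType d) (R : realType)
    (P : probability T R) (n : nat) (xi : {RV P >-> 'I_n.+1}) (k : nat) :
  max_stable xi ->
  P (xi @^-1` [set i : 'I_n.+1 | (i < k)%N]) = 0 \/
  P (xi @^-1` [set i : 'I_n.+1 | (i < k)%N]) = 1.
Proof.
move=> stable; apply: probability_idem; first exact: measurable_funPTI.
have mk : measurable [set i : 'I_n.+1 | (i < k)%N] by [].
have := stable _ _ _ _ _ (copy1_same_distribution xi)
  (copy2_same_distribution xi) (copies_independent xi) _ mk.
rewrite /distribution /pushforward => max_lt; rewrite -[RHS]max_lt.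
rewrite -[LHS]copies_joint_probability //; congr ((P \x P) _).
apply/seteqP; split=> t /=; rewrite /rv_max /copy1 /copy2.
  by case=> ? ?; case: leP.
case: leP => [le1 lt2|lt1 lt2]; split=> //.
  exact: leq_ltn_trans le1 lt2.
exact: ltn_trans lt1 lt2.
Qed.

Lemma max_stable_degenerate d (T : measurableType d) (R : realType)
    (P : probability T R) (n : nat) (xi : {RV P >-> 'I_n.+1}) :
  max_stable xi -> exists x : 'I_n.+1, degenerate_at xi x.
Proof.
move=> stable.
pose F k := P (xi @^-1` [set i : 'I_n.+1 | (i < k)%N]).
have F0 : F 0%N = 0.
  by rewrite /F (_ : [set _ | _] = set0) ?preimage_set0 ?measure0 // -subset0.
have Fn : F n.+1 = 1.
  rewrite /F (_ : [set _ | _] = setT) ?preimage_setT ?probability_setT //.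
  by apply/seteqP; split=> // i _ /=; exact: ltn_ord.
have exF : exists m, F m == 1 by exists n.+1; rewrite Fn.
(* As [F 0 = 0], the least [m] with [F m = 1] is a successor [k.+1]; the mass
   of [xi] is at [k]. *)
case: (ex_minnP exF) => -[|k] /eqP Fk min_k.
  by move: Fk; rewrite F0 => /eqP; rewrite eqe eq_sym oner_eq0.
have ltkn : (k < n.+1)%N by apply: min_k; rewrite Fn.
have Fk0 : F k = 0.
  have [//|Fk1] := max_stable_lt_zero_one k stable.
  by have := min_k k; rewrite /F Fk1 eqxx ltnn => /(_ isT).
exists (Ordinal ltkn); rewrite /degenerate_at -Fk -[LHS]adde0 -Fk0.
rewrite /F -measureU; [|exact: measurable_funPTI|exact: measurable_funPTI|].
- congr (P _); apply/seteqP; split=> t /=.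
    by case=> [->//|]; exact: ltnW.
  rewrite ltnS leq_eqVlt => /orP[/eqP e|]; [left|by right].
  exact: val_inj.
- by rewrite -subset0 => t /= [->] /=; rewrite ltnn.
Qed.

Theorem theorem7 (R : realType) (d : measure_display) (T : measurableType d)
    (P : probability T R) (n : nat) (xi : {RV P >-> 'I_n.+1}) :
  max_stable xi <-> exists x : 'I_n.+1, degenerate_at xi x.
Proof.
split=> [|[x xi_x]]; first exact: max_stable_degenerate.
move=> d' T' Q X Y sX sY indep A mA.
have mx : measurable [set x] by [].
have Xx : degenerate_at X x by rewrite /degenerate_at -xi_x; exact: sX.
have Yx : degenerate_at Y x by rewrite /degenerate_at -xi_x; exact: sY.
rewrite (degenerate_distribution mx mA xi_x).
apply: degenerate_distribution => //.
exact: degenerate_rv_max.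
Qed.
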